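(* Let $G=(V,E)$ be a complete bipartite graph $K_{r,s}$ ($r,s\ge1$), let $\emptyset\ne V_c\subsetneq V$, and let $g:V_c\to\{0,1\}$ be such that no two adjacent vertices of $V_c$ have the same value under $g$. Let $f$ be a maximum contrast greyscale for the $\{0,1\}$-restricted maximum contrast problem on $G$ with initial colouring $g$. Then its contrast vector $\mathcal C_f$ (the maximum contrast vector for the problem) has either all components equal to $1$ or else all components equal to $\frac12$.
   Context: Graphs are finite, undirected and simple. A greyscale of $G=(V,E)$ is a map $f:V\to[0,1]$ with $0,1\in \mathrm{Im}(f)$. For $e=\{u,v\}\in E$ put $\widehat f(e)=|f(u)-f(v)|$. The contrast vector $\mathcal C_f$ is the vector of all values $\widehat f(e)$, $e\in E$, listed in ascending order; contrast vectors are compared lexicographically. A greyscale $f$ is compatible with $g$ if $f(u)=g(u)$ for all $u\in V_c$. A maximum contrast greyscale for the $\{0,1\}$-restricted maximum contrast problem ($\{0,1\}$-RMACG) with data $(G,V_c,g)$ is a greyscale compatible with $g$ whose contrast vector is the lexicographic maximum among all greyscales of $G$ compatible with $g$. *)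

(* Defs.v *)
From HB Require Import structures.
From mathcomp Require Import all_boot all_order all_algebra.
From mathcomp Require Import reals.

Set Implicit Arguments.
Unset Strict Implicit.
Unset Printing Implicit Defensive.

Import Order.TTheory GRing.Theory Num.Theory.
Local Open Scope ring_scope.

Record sgraph := SGraph {
  vertex :> finType;
  adj : rel vertex;
  adj_sym : symmetric adj;
  adj_irrefl : irreflexive adj }.

Definition edges (G : sgraph) : {set {set G}} :=
  [set [set uv.1; uv.2] | uv : G * G & adj uv.1 uv.2].

Definition complete_bipartite (r s : nat) (G : sgraph) : Prop :=
  exists A : {set G},
    [/\ #|A| = r, #|~: A| = s
      & forall u v : G, adj u v = ((u \in A) != (v \in A))].

Section Greyscale.
Variables (R : realType) (G : sgraph).
Implicit Types (f : G -> R) (u v : G) (Vc : {set G}).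

Definition greyscale f : Prop :=
  [/\ forall v, 0 <= f v <= 1, exists u, f u = 0 & exists v, f v = 1].

(* [enum d] lists the two endpoints of [d] in an arbitrary order, which does
   not matter here; the default value is never used when [d] is an edge. *)
Definition edge_contrast f (d : {set G}) : R :=
  if enum d is [:: u; v] then `|f u - f v| else 0.

Lemma edge_contrast2 f u v :
  u != v -> edge_contrast f [set u; v] = `|f u - f v|.
Proof.
move=> neq_uv; rewrite /edge_contrast.
have: perm_eq (enum [set u; v]) [:: u; v].
  apply: uniq_perm; rewrite ?enum_uniq //= ?inE ?neq_uv // => x.
  by rewrite mem_enum !inE.
move=> E; case: (enum _) E => [|x [|y [|z s]]] E; try by move/perm_size: E.
have: x \in [:: u; v] by rewrite -(perm_mem E) mem_head.
rewrite !inE => /orP[]/eqP xE; rewrite {x}xE in E *.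
  by move: E; rewrite perm_cons => /perm_mem/(_ v); rewrite !inE eqxx => /eqP->.
have: perm_eq [:: v; y] [:: v; u] by rewrite (perm_trans E) // (perm_catC [:: u]).
by rewrite perm_cons => /perm_mem/(_ u); rewrite !inE eqxx distrC => /eqP->.
Qed.

Definition contrast_vector f : seq R :=
  sort <=%R [seq edge_contrast f d | d in edges G].

(* The [{0,1}]-restricted problem takes [g : Vc -> {0,1}]; [g] is viewed here
   as a real-valued map, and the restriction on its values is [zero_one g]. *)
Definition zero_one Vc (g : {v | v \in Vc} -> R) : Prop :=
  forall v : {v | v \in Vc}, g v = 0 \/ g v = 1.

Definition compatible Vc (g : {v | v \in Vc} -> R) f : Prop :=
  forall u : {v | v \in Vc}, f (val u) = g u.

(* The [seqlexi R] annotation selects the lexicographic order on [seq R]. *)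
Definition max_contrast_greyscale Vc (g : {v | v \in Vc} -> R) f : Prop :=
  [/\ greyscale f, compatible g f
    & forall f', greyscale f' -> compatible g f' ->
        ((contrast_vector f' : seqlexi R) <= contrast_vector f)%O].

End Greyscale.

(* Main.v *)
(** Because contrast vectors are sorted and have equal length, a single
  competitor whose contrasts are all at least [c] forces every contrast of the
  maximum greyscale [f] to be at least [c].  If [g] extends to a proper
  2-colouring, the 2-colouring is a competitor with [c = 1].  Otherwise [g]
  takes both values on one side of the bipartition and the other side is free;
  colouring the free side with 1/2 gives a competitor with [c = 1/2].  Being at
  distance at least 1/2 from both 0 and 1 then forces [f] to be 1/2 on the whole
  free side, and no value in [0, 1] is further than 1/2 from 1/2. *)
Require Import Defs.
From mathcomp Require Import all_boot all_order all_algebra.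
From mathcomp Require Import reals.
From mathcomp Require Import lra.

Import Order.TTheory GRing.Theory Num.Theory.
Local Open Scope ring_scope.

Lemma mem_contrast_vector (R : realType) (G : sgraph) (f : G -> R) (x : R) :
  reflect (exists2 uv : G * G, adj uv.1 uv.2 & x = `|f uv.1 - f uv.2|)
          (x \in contrast_vector f).
Proof.
have edgeE (u v : G) : adj u v -> edge_contrast f [set u; v] = `|f u - f v|.
  move=> uv; apply: edge_contrast2; apply: contraTneq uv => ->.
  by rewrite adj_irrefl.
rewrite /contrast_vector mem_sort; apply: (iffP imageP) => [[d] | [uv adj_uv ->]].
  case/imsetP=> uv; rewrite inE => adj_uv -> ->.
  by exists uv => //; rewrite edgeE.
exists [set uv.1; uv.2]; last by rewrite edgeE.
by apply/imsetP; exists uv; rewrite ?inE.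
Qed.

Lemma size_contrast_vector (R : realType) (G : sgraph) (f : G -> R) :
  size (contrast_vector f) = #|edges G|.
Proof. by rewrite /contrast_vector size_sort size_image. Qed.

(** The lexicographic order compares heads first, and the head of the sorted [t] is its minimum.
    Equal sizes exclude an empty [s] against a nonempty [t]. *)
Lemma lexi_sorted_lower_bound (R : realType) (c : R) (s t : seq R) :
    size s = size t -> sorted <=%R t -> (forall x, x \in s -> c <= x) ->
    ((s : seqlexi R) <= t)%O ->
  forall x, x \in t -> c <= x.
Proof.
case: t => [|y t]; first by [].
case: s => [|z s] //= _ sorted_t s_ge; rewrite lexi_cons => /andP[le_zy _] x xt.
apply: le_trans (s_ge z (mem_head _ _)) (le_trans le_zy _).
move: xt; rewrite inE => /orP[/eqP-> // | xt].
exact: (allP (order_path_min le_trans sorted_t)).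
Qed.

Lemma max_contrast_lower_bound (R : realType) (G : sgraph) (Vc : {set G})
    (g : {v : G | v \in Vc} -> R) (f f' : G -> R) (c : R) :
    max_contrast_greyscale g f -> greyscale f' ->
    (forall v, v \in Vc -> f' v = f v) ->
    (forall u v : G, adj u v -> c <= `|f' u - f' v|) ->
  forall u v : G, adj u v -> c <= `|f u - f v|.
Proof.
move=> [_ f_g f_max] f'_grey f'f f'_ge u v adj_uv.
have f'_g : compatible g f' by move=> w; rewrite f'f ?(valP w) // f_g.
apply: (lexi_sorted_lower_bound _ _ _ _ _ _ _ (f_max _ f'_grey f'_g)).
- by rewrite !size_contrast_vector.
- exact/sort_sorted/le_total.
- by move=> x /mem_contrast_vector[uv ? ->]; apply: f'_ge.
- by apply/mem_contrast_vector; exists (u, v).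
Qed.

Lemma half_of_far_from_01 (R : realType) (x : R) :
  1 / 2 <= `|x - 0| -> 1 / 2 <= `|x - 1| -> 0 <= x <= 1 -> x = 1 / 2.
Proof.
rewrite subr0 => + + /andP[x0 x1].
rewrite ger0_norm // distrC ger0_norm ?subr_ge0 //; lra.
Qed.

Theorem theorem5p4 (R : realType) (r s : nat) (G : sgraph) (Vc : {set G})
    (g : {v : G | v \in Vc} -> R) (f : G -> R)
    (r_ge1 : (1 <= r)%N) (s_ge1 : (1 <= s)%N)
    (G_Krs : complete_bipartite r s G)
    (Vc_neq0 : Vc != set0) (Vc_proper : Vc \proper [set: G])
    (g01 : zero_one g)
    (g_adj : forall u v : {v : G | v \in Vc},
       adj (val u) (val v) -> g u <> g v)
    (f_max : max_contrast_greyscale g f) :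
  (forall x, x \in contrast_vector f -> x = 1) \/
  (forall x, x \in contrast_vector f -> x = 1 / 2).
Proof.
have [[f_bnd _ _] f_g _] := f_max.
(* The hypotheses on [g] are transferred to [f], so that the subtype over [Vc] can be left
   behind. *)
have f01 v : v \in Vc -> f v = 0 \/ f v = 1.
  by move=> vVc; rewrite (f_g (exist _ v vVc)); apply: g01.
have f_adj u v : u \in Vc -> v \in Vc -> adj u v -> f u <> f v.
  move=> uVc vVc; rewrite (f_g (exist _ u uVc)) (f_g (exist _ v vVc)).
  exact: (g_adj (exist _ u uVc) (exist _ v vVc)).
case: G_Krs => A [cardA cardAC adjE].
have [a aA] : exists a, a \in A by apply/card_gt0P; rewrite cardA.
have [b bA] : exists b, b \in ~: A by apply/card_gt0P; rewrite cardAC.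
rewrite inE in bA.
have [v0 v0Vc] := set0Pn _ Vc_neq0.
have dist_le1 u v : `|f u - f v| <= 1.
  have /andP[? ?] := f_bnd u; have /andP[? ?] := f_bnd v.
  by rewrite ler_norml; apply/andP; split; lra.
(* The only proper 2-colouring with values 0 and 1 that agrees with [f] at [v0]. *)
pose col v := if (v \in A) == (v0 \in A) then f v0 else 1 - f v0.
have [/forall_inP f_col | ] := boolP [forall v in Vc, col v == f v].
  left => x /mem_contrast_vector[[u v] /= adj_uv ->].
  apply/eqP; rewrite eq_le dist_le1 /=.
  apply: (max_contrast_lower_bound _ _ _ _ _ col _ f_max) => //; last 2 first.
  - by move=> w /f_col/eqP.
  - move=> {adj_uv}u {}v; rewrite adjE /col.
    case: (u \in A); case: (v \in A); case: (v0 \in A) => //= _;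
      by case: (f01 _ v0Vc) => ->; rewrite ?subrr ?subr0 ?sub0r ?normrN ?normr1.
  split.
  - move=> w; rewrite /col; case: ifP => _; case: (f01 _ v0Vc) => ->;
      by rewrite ?subr0 ?subrr ?lexx ?ler01.
  (* The value not taken at [v0] is taken on the opposite side, which contains [a] or [b]. *)
  - case: (f01 _ v0Vc) => E; [exists v0; by rewrite /col eqxx|].
    by exists (if v0 \in A then b else a); rewrite /col E;
      case: (v0 \in A); rewrite ?aA ?(negPf bA) /= subrr.
  - case: (f01 _ v0Vc) => E; [|exists v0; by rewrite /col eqxx].
    by exists (if v0 \in A then b else a); rewrite /col E;
      case: (v0 \in A); rewrite ?aA ?(negPf bA) /= subr0.
rewrite negb_forall_in => /exists_inP[v1 v1Vc]; rewrite /col.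
(* Across from [v0], adjacency would force [f v1 = 1 - f v0 = col v1]; so [v1] lies on the side of
   [v0] with the other value. *)
have [side1 | side1] := eqVneq (v1 \in A) (v0 \in A); last first.
  have := f_adj _ _ v1Vc v0Vc; rewrite adjE => /(_ side1).
  by case: (f01 _ v0Vc) => ->; case: (f01 _ v1Vc) => -> //;
    rewrite ?subr0 ?subrr ?eqxx.
move=> f01_neq; right.
(* A vertex of [Vc] on the other side would be adjacent to both [v0] and [v1], hence differ from
   both 0 and 1. *)
have Vc_side w : w \in Vc -> (w \in A) = (v0 \in A).
  move=> wVc; apply/eqP/negPn/negP => side_w.
  have := f_adj _ _ wVc v0Vc; rewrite adjE => /(_ side_w).
  have := f_adj _ _ wVc v1Vc; rewrite adjE side1 => /(_ side_w).
  by move: f01_neq; case: (f01 _ v0Vc) => ->; case: (f01 _ v1Vc) => ->;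
    case: (f01 _ wVc) => ->; rewrite ?eqxx.
have [p [q [pVc qVc fp fq]]] : exists p q, [/\ p \in Vc, q \in Vc, f p = 0 & f q = 1].
  move: f01_neq; case: (f01 _ v0Vc) => E0; case: (f01 _ v1Vc) => E1;
    rewrite E0 E1 ?eqxx // => _; by [exists v0, v1 | exists v1, v0].
(* The 0 on uncoloured vertices of this side is arbitrary: 1 is equally far from 1/2. *)
pose h w := if (w \in A) == (v0 \in A) then if w \in Vc then f w else 0 else 1 / 2.
have h_f w : w \in Vc -> h w = f w by move=> wVc; rewrite /h wVc Vc_side ?eqxx.
have h_side w : (w \in A) = (v0 \in A) -> h w = 0 \/ h w = 1.
  by rewrite /h => ->; rewrite eqxx; case: ifP => [/f01 | _]; [|left].
have f_far : forall u v : G, adj u v -> 1 / 2 <= `|f u - f v|.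
  apply: (max_contrast_lower_bound _ _ _ _ _ h _ f_max) => //.
    split; [|exists p; by rewrite h_f | exists q; by rewrite h_f].
    move=> w; rewrite /h; case: ifP => _; last by apply/andP; split; lra.
    by case: ifP => _; rewrite ?f_bnd ?lexx ?ler01.
  suff h_far u v : (u \in A) = (v0 \in A) -> (v \in A) != (v0 \in A) ->
      1 / 2 <= `|h u - h v|.
    move=> u v; rewrite adjE => side_uv.
    have [side_u | side_u] := eqVneq (u \in A) (v0 \in A).
      by apply: h_far; rewrite // -side_u eq_sym.
    rewrite distrC; apply: h_far => //.
    by move: side_uv side_u; case: (u \in A); case: (v \in A); case: (v0 \in A).
  move=> side_u side_v; have -> : h v = 1 / 2 by rewrite /h (negPf side_v).
  rewrite ler_normr; apply/orP.
  by case: (h_side u side_u) => ->; [right | left]; lra.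
(* Such a [w] is adjacent to both [p] and [q], where [f] is 0 and 1. *)
have f_half w : (w \in A) != (v0 \in A) -> f w = 1 / 2.
  move=> side_w; apply: half_of_far_from_01 (f_bnd w).
    by have := f_far w p; rewrite fp adjE (Vc_side _ pVc); apply.
  by have := f_far w q; rewrite fq adjE (Vc_side _ qVc); apply.
have half_le u w : (w \in A) != (v0 \in A) -> `|f u - f w| <= 1 / 2.
  move=> /f_half ->; have /andP[? ?] := f_bnd u.
  by rewrite ler_norml; apply/andP; split; lra.
move=> x /mem_contrast_vector[[u v] /= adj_uv ->].
apply/eqP; rewrite eq_le f_far // andbT.
(* Exactly one endpoint lies opposite [v0]; [half_le] is applied to that one. *)
have [side_v | /half_le-> //] := eqVneq (v \in A) (v0 \in A).
by rewrite distrC half_le // -side_v -adjE.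
Qed.
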